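(* Let $k,\alpha,\beta\in\mathbb{Z}^+$, let $X$ be a real Banach space satisfying $\dim(X)\ge k+3$, $1\le\alpha\le\dim(X)-(k+2)$ and $k+2\le\beta\le\dim(X)-1$, and let $x\in S_X$. Then the following statements are equivalent. (1) $X$ is $k$-WLUR at $x$. (2) For every $\epsilon>0$ and $f_1,\dots,f_k\in S_{X^*}$, $\inf\{\delta^k_{X/M}(\epsilon,x+M,(f_j)_{j=1}^k): M\subseteq\bigcap_{j=1}^k\ker(f_j)\text{ and }d(x,M)=1\}>0$, the infimum being over subspaces $M$ of $X$. (3) For every $\epsilon>0$ and $f_1,\dots,f_k\in S_{X^*}$, $\inf\{\delta^k_{X/F}(\epsilon,x+F,(f_j)_{j=1}^k): \dim(F)=\alpha,\ F\subseteq\bigcap_{j=1}^k\ker(f_j)\text{ and }d(x,F)=1\}>0$, the infimum being over subspaces $F$ of $X$. (4) For every $\epsilon>0$ and $f_1,\dots,f_k\in S_{X^*}$, $\inf\{\delta^k_{X/Y}(\epsilon,x+Y,(f_j)_{j=1}^k): \operatorname{codim}(Y)=\beta,\ Y\subseteq\bigcap_{j=1}^k\ker(f_j)\text{ and }d(x,Y)=1\}>0$, the infimum being over subspaces $Y$ of $X$.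
   Context: $X$ may be infinite-dimensional (then the upper bounds on $\alpha,\beta$ are vacuous). All subspaces are assumed closed. The infimum of the empty set is $+\infty$. $S_Z$ is the unit sphere of a Banach space $Z$ and $Z^*$ its dual; $d(x,M)=\inf\{\|x-y\|:y\in M\}$. For $z_1,\dots,z_{k+1}\in Z$ and $f_1,\dots,f_k\in Z^*$, $D_k[(z_i)_{i=1}^{k+1};(f_j)_{j=1}^{k}]$ denotes the determinant of the $(k+1)\times(k+1)$ matrix whose first row consists of ones and whose $(j+1,i)$ entry is $f_j(z_i)$. For a Banach space $Z$, $z\in S_Z$, $\epsilon>0$ and $f_1,\dots,f_k\in S_{Z^*}$, $$\delta^k_Z(\epsilon,z,(f_j)_{j=1}^k):=\inf\Big(\{1\}\cup\Big\{1-\tfrac{1}{k+1}\Big\|z+\sum_{i=1}^{k}z_i\Big\| : z_1,\dots,z_{k}\in S_Z,\ |D_k[z,(z_i)_{i=1}^{k};(f_j)_{j=1}^{k}]|\ge\epsilon\Big\}\Big).$$ $Z$ is $k$-weakly locally uniformly rotund ($k$-WLUR) at $z$ if $\delta^k_Z(\epsilon,z,(f_j)_{j=1}^k)>0$ for every $\epsilon>0$ and $f_1,\dots,f_k\in S_{Z^*}$. For a subspace $M\subseteq X$, $(X/M)^*$ is identified isometrically with $M^\perp=\{f\in X^*:f|_M=0\}$; so if $M\subseteq\bigcap_j\ker(f_j)$, each $f_j\in S_{X^*}$ is regarded as an element of $S_{(X/M)^*}$ via $f_j(y+M)=f_j(y)$. *)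

(* Defs.v *)
From HB Require Import structures.
From mathcomp Require Import all_boot all_order all_algebra.
From mathcomp Require Import all_classical all_reals all_analysis.

Set Implicit Arguments.
Unset Strict Implicit.
Unset Printing Implicit Defensive.

Import Order.TTheory GRing.Theory Num.Theory.
Import numFieldNormedType.Exports.

Local Open Scope classical_set_scope.
Local Open Scope ring_scope.
Local Open Scope quotient_scope.

Section Dimension.
Context {R : realType} {V : lmodType R}.

Definition lin_indep n (v : 'I_n -> V) :=
  forall c : 'I_n -> R, \sum_(i < n) c i *: v i = 0 -> forall i, c i = 0.

(* Dimension of a linear subspace A, valued in the extended reals: the natural
   number dim A when A is finite-dimensional, +oo otherwise. *)
Definition dimension (A : set V) : \bar R :=
  ereal_sup [set n%:R%:E | n in [set n : nat |
    exists v : 'I_n -> V, (forall i, A (v i)) /\ lin_indep v]].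

End Dimension.

Section Dual.
Context {R : realType} {Z : normedModType R}.

Definition opnorm (f : {linear Z -> R^o}) : R :=
  sup [set `|f z| | z in [set z | `|z| <= 1]].

(* f \in S_{Z^*}; since sup is 0 on unbounded sets, [continuous] is kept
   explicit. *)
Definition dual_sphere (f : {linear Z -> R^o}) : Prop :=
  continuous f /\ opnorm f = 1.

End Dual.

Section Rotundity.
Context {R : realType} {Z : normedModType R}.
Variable k : nat.

Definition fcons (z : Z) (zs : 'I_k -> Z) : 'I_k.+1 -> Z :=
  fun i => oapp zs z (unlift ord0 i).

Definition Ddet (z : 'I_k.+1 -> Z) (f : 'I_k -> {linear Z -> R^o}) : R :=
  \det (\matrix_(r < k.+1, c < k.+1)
    oapp (fun j => f j (z c)) (1 : R) (unlift ord0 r)).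

(* The values are in [0, 1], so that the real-valued infimum is the genuine
   one. *)
Definition kdelta (eps : R) (z : Z) (f : 'I_k -> {linear Z -> R^o}) : R :=
  inf ([set 1] `|`
       [set 1 - (k.+1)%:R^-1 * `|z + \sum_(i < k) zs i| | zs in
         [set zs : 'I_k -> Z | (forall i, `|zs i| = 1) /\
                               eps <= `|Ddet (fcons z zs) f| ]]).

Definition WLUR_at (z : Z) : Prop :=
  forall (eps : R) (f : 'I_k -> {linear Z -> R^o}),
    0 < eps -> (forall j, dual_sphere (f j)) -> 0 < kdelta eps z f.

End Rotundity.

Section Quotient.
Context {R : realType} {X : normedModType R}.

Record closed_subspace := ClosedSubspace {
  subspace_set :> set X ;
  subspace_submod : submod_closed (fun x => `[< subspace_set x >]) ;
  subspace_closed : closed subspace_set }.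

Definition dist_to (x : X) (M : set X) : R := inf [set `|x - y| | y in M].

Definition subspace_pred (M : closed_subspace) : {pred X} := fun x => `[< subspace_set M x >].

HB.instance Definition _ (M : closed_subspace) :=
  GRing.isZmodClosed.Build X (subspace_pred M)
    (GRing.submod_closedB (subspace_submod M)).

Definition quotient (M : closed_subspace) := Quotient.quot (subspace_pred M).

HB.instance Definition _ (M : closed_subspace) := GRing.Zmodule.on (quotient M).

Variable M : closed_subspace.

Definition qproj (x : X) : quotient M := \pi_(Quotient.quot (subspace_pred M)) x.
Definition qrepr (u : quotient M) : X :=
  repr (u : Quotient.quot (subspace_pred M)).

Lemma qreprK u : qproj (qrepr u) = u.
Proof. exact: reprK. Qed.

Lemma qproj_eq x y : qproj x = qproj y <-> subspace_set M (x - y).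
Proof.
split=> [e|h].
  by apply/asboolP; move/eqP: e; rewrite /qproj -Quotient.idealrBE.
by apply/eqP; rewrite /qproj -Quotient.idealrBE; apply/asboolP.
Qed.

Lemma subspace0 : subspace_set M 0.
Proof. by have [/asboolP] := subspace_submod M. Qed.

Lemma subspaceD x y : subspace_set M x -> subspace_set M y -> subspace_set M (x + y).
Proof.
move=> hx hy; have [_ h] := subspace_submod M.
by have /asboolP := h 1 x y (asboolT hx) (asboolT hy); rewrite scale1r.
Qed.

Lemma subspaceZ a x : subspace_set M x -> subspace_set M (a *: x).
Proof.
move=> hx; have [h0 h] := subspace_submod M.
by have /asboolP := h a x 0 (asboolT hx) h0; rewrite addr0.
Qed.

Lemma subspaceN x : subspace_set M x -> subspace_set M (- x).
Proof. by move=> hx; rewrite -scaleN1r; apply: subspaceZ. Qed.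

Lemma qprojD x y : qproj (x + y) = qproj x + qproj y.
Proof. exact: raddfD. Qed.

Lemma qreprP x : subspace_set M (x - qrepr (qproj x)).
Proof. by apply/qproj_eq; rewrite qreprK. Qed.

Definition qscale (a : R) (u : quotient M) : quotient M := qproj (a *: qrepr u).

Lemma qprojZ_subproof a x : qscale a (qproj x) = qproj (a *: x).
Proof.
apply/qproj_eq; rewrite -scalerBr -opprB scalerN.
exact/subspaceN/subspaceZ/qreprP.
Qed.

Lemma qscaleA a b u : qscale a (qscale b u) = qscale (a * b) u.
Proof. by rewrite [qscale b u]/qscale qprojZ_subproof scalerA. Qed.

Lemma qscale1 : left_id 1 qscale.
Proof. by move=> u; rewrite /qscale scale1r qreprK. Qed.

Lemma qscaleDr : right_distributive qscale +%R.
Proof.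
move=> a u v; rewrite -[u]qreprK -[v]qreprK -qprojD !qprojZ_subproof.
by rewrite scalerDr qprojD.
Qed.

Lemma qscaleDl u : {morph qscale^~ u : a b / a + b}.
Proof. by move=> a b; rewrite /qscale scalerDl qprojD. Qed.

HB.instance Definition _ :=
  GRing.Zmodule_isLmodule.Build R (quotient M) qscaleA qscale1 qscaleDr qscaleDl.

Lemma qproj_is_linear : linear qproj.
Proof.
by move=> a x y; rewrite qprojD -qprojZ_subproof.
Qed.

HB.instance Definition _ :=
  GRing.isLinear.Build R X (quotient M) _ qproj qproj_is_linear.

Definition qnorm (u : quotient M) : R := dist_to (qrepr u) M.

Let dist_lb (x : X) : has_lbound [set `|x - y| | y in M].
Proof. by exists 0 => _ [y _ <-]. Qed.

Let dist_ne (x : X) : [set `|x - y| | y in M] !=set0.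
Proof. by exists `|x - 0|, 0 => //; exact: subspace0. Qed.

Lemma dist_ge0 x : 0 <= dist_to x M.
Proof. by apply: lb_le_inf => // _ [y _ <-]. Qed.

Lemma dist_le x y : subspace_set M y -> dist_to x M <= `|x - y|.
Proof. by move=> My; apply: ge_inf => //; exists y. Qed.

Lemma dist_lt x e : dist_to x M < e -> exists2 y, subspace_set M y & `|x - y| < e.
Proof. by move=> /(inf_lt (dist_ne x))[_ [y My <-] he]; exists y. Qed.

Lemma qnormE x : qnorm (qproj x) = dist_to x M.
Proof.
rewrite /qnorm /dist_to; congr inf; apply/seteqP; split=> _ [y My <-].
  exists (x - qrepr (qproj x) + y); first exact: subspaceD (qreprP x) My.
  by congr (`|_|); rewrite !opprD opprK addrA addrA subrr add0r.
exists (y - (x - qrepr (qproj x))).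
  by apply: subspaceD => //; apply/subspaceN/qreprP.
by congr (`|_|); rewrite opprB addrA addrCA subrr addr0.
Qed.

Lemma ler_qnormD u v : qnorm (u + v) <= qnorm u + qnorm v.
Proof.
rewrite -[u]qreprK -[v]qreprK -qprojD !qnormE.
apply/ler_addgt0Pr => e e0.
have e2 : 0 < e / 2 by rewrite divr_gt0.
have [y My hy] := @dist_lt (qrepr u) (dist_to (qrepr u) M + e / 2)
  ltac:(by rewrite ltrDl).
have [z Mz hz] := @dist_lt (qrepr v) (dist_to (qrepr v) M + e / 2)
  ltac:(by rewrite ltrDl).
apply: le_trans (dist_le _ (subspaceD My Mz)) _.
rewrite opprD addrACA; apply: le_trans (ler_normD _ _) _.
by rewrite [e in leRHS]splitr addrACA lerD// ltW.
Qed.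

Let qnormZ_le a u : qnorm (a *: u) <= `|a| * qnorm u.
Proof.
rewrite -[u]qreprK -[a *: _]linearZ !qnormE.
have [->|a0] := eqVneq a 0.
  rewrite scale0r normr0 mul0r.
  by apply: le_trans (dist_le _ subspace0) _; rewrite subr0 normr0.
rewrite mulrC -ler_pdivrMr ?normr_gt0//.
apply: lb_le_inf => // _ [y My <-].
rewrite ler_pdivrMr ?normr_gt0// mulrC -normrZ scalerBr.
by apply: dist_le; apply: subspaceZ.
Qed.

Lemma qnormZ a u : qnorm (a *: u) = `|a| * qnorm u.
Proof.
apply/eqP; rewrite eq_le qnormZ_le /=.
have [->|a0] := eqVneq a 0; first by rewrite normr0 mul0r dist_ge0.
rewrite -[in leLHS](scalerK a0 u) -ler_pdivlMl ?normr_gt0// -normfV.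
exact: qnormZ_le.
Qed.

Lemma qnorm0_eq0 u : qnorm u = 0 -> u = 0.
Proof.
rewrite -[u]qreprK qnormE => h.
rewrite -(raddf0 qproj); apply/qproj_eq; rewrite subr0.
rewrite -/(subspace_set M _); apply: (subspace_closed (c := M)) => B.
rewrite -nbhs_ballE => -[e /= e0 hB].
have [y My hy] := @dist_lt (qrepr u) e ltac:(by rewrite h).
by exists y; split => //; apply: hB; rewrite -ball_normE.
Qed.

HB.instance Definition _ :=
  Lmodule_isNormed.Build R (quotient M) ler_qnormD qnormZ qnorm0_eq0.

(* The functional on X/M induced by a functional f vanishing on M;
   see qfunE. *)
Definition qfun (f : {linear X -> R^o}) of M `<=` f @^-1` [set 0] :
  quotient M -> R^o := fun u => f (qrepr u).

Lemma qfunE (f : {linear X -> R^o}) (hf : M `<=` f @^-1` [set 0]) x :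
  qfun hf (qproj x) = f x.
Proof.
by apply/esym/eqP; rewrite -subr_eq0 -linearB; apply/eqP/hf/qreprP.
Qed.

Lemma qfun_is_linear (f : {linear X -> R^o}) (hf : M `<=` f @^-1` [set 0]) : linear (qfun hf).
Proof.
move=> a u v; rewrite -[u]qreprK -[v]qreprK.
by rewrite -linearP !qfunE linearP.
Qed.

HB.instance Definition _ (f : {linear X -> R^o}) (hf : M `<=` f @^-1` [set 0]) :=
  GRing.isLinear.Build R (quotient M) R^o _ (qfun hf) (qfun_is_linear hf).

Definition codimension : \bar R := dimension [set: quotient M].

End Quotient.

Arguments closed_subspace {R} X.
Arguments qproj {R X} M x.

(* The set of the kdelta of X/M at (eps, x + M, f), M ranging over the closed
   subspaces that satisfy P, lie in all the kernels ker f_j, and are at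
   distance 1 from x. It is taken in the extended reals so that its ereal_inf
   is +oo when there is no such M. *)
Definition quotient_deltas {R : realType} {X : normedModType R} (k : nat)
    (P : closed_subspace X -> Prop) (eps : R) (x : X)
    (f : 'I_k -> {linear X -> R^o}) : set (\bar R) :=
  [set d | exists (M : closed_subspace X)
                  (hM : forall j, M `<=` f j @^-1` [set 0]),
    [/\ P M, dist_to x M = 1 &
        d = (kdelta eps (qproj M x) (fun j => qfun (hM j)))%:E ] ].

(* Main.v *)
(* The determinant is Lipschitz in the values [f_j z_i], uniformly over
   contractive [f_j] and unit vectors, so replacing the [z_i] by nearby unit
   vectors only costs half of [eps]. Hence (1) implies (2) by lifting unit vectors
   of X/M to nearly unit vectors of X. Conversely, let [z_i] be unit vectors of X
   with ||x + sum z_i|| close to k + 1. Quotienting by any M inside the kernels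
   of the [f_j] and of two functionals norming x and x + sum z_i (Hahn-Banach)
   keeps x of norm 1, the [z_i] nearly of norm 1 and the norm of the sum. These
   are k + 2 kernels, so M can be given dimension alpha or codimension beta. *)

Require Import Defs.
From HB Require Import structures.
From mathcomp Require Import all_boot all_order all_algebra.
From mathcomp Require Import all_classical all_reals all_analysis.
From mathcomp Require Import perm lra.
Import Order.TTheory GRing.Theory Num.Theory.
Import numFieldNormedType.Exports.
Local Open Scope classical_set_scope.
Local Open Scope ring_scope.

Set Implicit Arguments.
Unset Strict Implicit.
Unset Printing Implicit Defensive.

(** * The Hahn-Banach theorem *)

Section Sublinear.
Context {R : realType} {V : lmodType R}.
Implicit Types p q : V -> R.

Definition sublinear p :=
  (forall x y, p (x + y) <= p x + p y) /\
  (forall a x, 0 < a -> p (a *: x) <= a * p x).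

Lemma sublinearZ p a x : sublinear p -> 0 < a -> p (a *: x) = a * p x.
Proof.
move=> [_ pZ] a0; apply/eqP; rewrite eq_le pZ//=.
by rewrite -ler_pdivlMl// -[in leLHS](scalerK (lt0r_neq0 a0) x) pZ ?invr_gt0.
Qed.

Lemma sublinear0 p : sublinear p -> p 0 = 0.
Proof.
by move=> sp; have := @sublinearZ p 2 0 sp (ltr0Sn _ _); rewrite scaler0 => h; lra.
Qed.

Lemma sublinear_geN p x : sublinear p -> - p (- x) <= p x.
Proof.
move=> sp; have := sp.1 x (- x); rewrite subrr sublinear0// => h; lra.
Qed.

(** Lower bound of a chain for Zorn. Subadditivity is where the chain condition enters: of two
    near-minimisers at [x] and [y], the smaller serves both points. *)
Lemma sublinear_inf (A : set (V -> R)) q : A !=set0 ->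
  (forall p, A p -> sublinear p /\ forall x, p x <= q x) ->
  total_on A (fun p p' => forall x, p x <= p' x) ->
  let m x := inf [set p x | p in A] in
  sublinear m /\ forall p, A p -> forall x, m x <= p x.
Proof.
move=> [p0 Ap0] Aq Atot m.
have lbA x : has_lbound [set p x | p in A].
  exists (- q (- x)) => _ [p Ap <-]; have [sp pq] := Aq _ Ap.
  by apply: le_trans (sublinear_geN x sp); rewrite lerN2.
have neA x : [set p x | p in A] !=set0 by exists (p0 x), p0.
have mle p : A p -> forall x, m x <= p x.
  by move=> Ap x; apply: ge_inf => //; exists p.
split=> //; split=> [x y|a x a0].
  apply/ler_addgt0Pr => e e0.
  have [_ [p Ap <-] hp] : exists2 r, [set p x | p in A] r & r < m x + e / 2.
    by apply: inf_lt => //; rewrite ltrDl divr_gt0.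
  have [_ [p' Ap' <-] hp'] : exists2 r, [set p y | p in A] r & r < m y + e / 2.
    by apply: inf_lt => //; rewrite ltrDl divr_gt0.
  have [h|h] := Atot _ _ Ap Ap'.
    have := (Aq _ Ap).1.1 x y; have := mle _ Ap (x + y); have := h y; lra.
  have := (Aq _ Ap').1.1 x y; have := mle _ Ap' (x + y); have := h x; lra.
rewrite -ler_pdivrMl//; apply: lb_le_inf => // _ [p Ap <-].
rewrite ler_pdivrMl// -(sublinearZ _ (Aq _ Ap).1 a0); exact: mle.
Qed.

Lemma sublinear_minimal q : sublinear q ->
  exists p, [/\ sublinear p, forall x, p x <= q x &
    forall p', sublinear p' -> (forall x, p' x <= p x) -> p' = p].
Proof.
move=> sq; pose T := {p | sublinear p /\ forall x, p x <= q x}.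
(* The order is reversed, so that Zorn's maximal elements are minimal functionals. *)
pose le (s t : T) := `[< forall x, sval t x <= sval s x >].
have [||||p pmin] := @Zorn T le.
- by move=> t; apply/asboolP.
- move=> r s t /asboolP rs /asboolP st; apply/asboolP => x.
  exact: le_trans (st x) (rs x).
- move=> [s sP] [t tP] /asboolP /= st /asboolP /= ts.
  apply: eq_exist; apply/funext => x; apply/eqP; rewrite eq_le.
  by rewrite ts st.
- move=> A Atot; have [[[p0 p0P] Ap0]|/set0P/negP/negPn/eqP->] := pselect (A !=set0); last first.
    by exists (exist _ q (conj sq (fun x => lexx _))) => s.
  have [|p Ap||sm mle] := @sublinear_inf [set sval s | s in A] q.
  - by exists p0; exists (exist _ p0 p0P).
  - by case: Ap => -[s sP] _ <-.
  - move=> _ _ [s As <-] [t At <-]; have [/asboolP|/asboolP] := Atot _ _ As At.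
      by right.
    by left.
  have mq : forall x, inf [set p x | p in [set sval s | s in A]] <= q x.
    move=> x; apply: le_trans (p0P.2 x); apply: mle.
    by exists (exist _ p0 p0P).
  exists (exist (fun p => sublinear p /\ forall x, p x <= q x) _ (conj sm mq)) => s As; apply/asboolP => x /=.
  by apply: mle; exists s.
exists (sval p); case: p pmin => p [sp pq] pmin; split=> //= p' sp' p'p.
have p'q x : p' x <= q x by exact: le_trans (p'p x) (pq x).
by have /(congr1 sval) := pmin (exist (fun p => sublinear p /\ forall x, p x <= q x) p' (conj sp' p'q)) (asboolT p'p).
Qed.

(* The largest sublinear [p'] below [p] with [p' (- y) = - p y]; a minimal [p]
   equals all its shifts, which makes it additive. *)
Definition sublinear_shift p y : V -> R :=
  fun x => inf [set p (x + t *: y) - t * p y | t in [set t | 0 <= t]].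

Section Shift.
Variables (p : V -> R) (y : V).
Hypothesis sp : sublinear p.

Let pZ t x : 0 <= t -> p (t *: x) = t * p x.
Proof.
rewrite le_eqVlt => /predU1P[<-|]; first by rewrite scale0r mul0r sublinear0.
exact: sublinearZ.
Qed.

Lemma sublinear_shift_lb t x : 0 <= t ->
  sublinear_shift p y x <= p (x + t *: y) - t * p y.
Proof.
move=> t0; apply: ge_inf; last by exists t.
(* Bounded below because [s * p y = p (s *: y) <= p (x + s *: y) + p (- x)]. *)
exists (- p (- x)) => _ [s s0 <-].
have := sp.1 (x + s *: y) (- x); rewrite addrAC subrr add0r pZ// => h; lra.
Qed.

Lemma sublinear_shift_glb c x :
  (forall t, 0 <= t -> c <= p (x + t *: y) - t * p y) ->
  c <= sublinear_shift p y x.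
Proof.
move=> h; apply: lb_le_inf => [|_ [t t0 <-]]; last exact: h.
by exists (p (x + 0 *: y) - 0 * p y), 0 => /=.
Qed.

Lemma sublinear_shift_sublinear : sublinear (sublinear_shift p y).
Proof.
split=> [u v|a x a0].
  rewrite -lerBlDr; apply: sublinear_shift_glb => s s0.
  rewrite lerBlDr -lerBlDl; apply: sublinear_shift_glb => t t0.
  have := sublinear_shift_lb (u + v) (addr_ge0 s0 t0).
  rewrite scalerDl addrACA; have := sp.1 (u + s *: y) (v + t *: y) => h1 h2.
  lra.
rewrite -ler_pdivrMl//; apply: sublinear_shift_glb => t t0.
rewrite ler_pdivrMl//.
have := sublinear_shift_lb (a *: x) (mulr_ge0 (ltW a0) t0).
by rewrite -scalerA -scalerDr (sublinearZ _ sp a0) => h; lra.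
Qed.

Lemma sublinear_shift_le x : sublinear_shift p y x <= p x.
Proof.
by have := sublinear_shift_lb x (lexx 0); rewrite scale0r mul0r subr0 addr0.
Qed.

Lemma sublinear_shiftD x : sublinear_shift p y x <= p (x + y) - p y.
Proof. by have := sublinear_shift_lb x ler01; rewrite scale1r mul1r. Qed.

End Shift.

(** Comparing [p] with its shift by [y] at parameter 1 gives superadditivity. Additivity makes [p]
    odd, which carries homogeneity over to negative scalars. *)
Lemma linear_of_minimal_sublinear p : sublinear p ->
  (forall p', sublinear p' -> (forall x, p' x <= p x) -> p' = p) ->
  linear (p : V -> R^o).
Proof.
move=> sp pmin.
have pD x y : p (x + y) = p x + p y.
  apply/eqP; rewrite eq_le sp.1 /= -lerBrDr.
  have <- := pmin _ (sublinear_shift_sublinear y sp) (sublinear_shift_le y sp).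
  by rewrite [in leRHS](pmin _ (sublinear_shift_sublinear y sp)
    (sublinear_shift_le y sp)) sublinear_shiftD.
have pN x : p (- x) = - p x.
  by apply/eqP; rewrite -addr_eq0 -pD addNr sublinear0.
move=> a x y; rewrite pD; congr (_ + _).
have [a0|a0|<-] := ltgtP 0 a; first exact: sublinearZ.
  rewrite -[a]opprK scaleNr pN sublinearZ ?oppr_gt0//.
  by rewrite scaleNr.
by rewrite !scale0r sublinear0.
Qed.

End Sublinear.

Section HahnBanach.
Context {R : realType} {X : normedModType R}.
Implicit Types f : {linear X -> R^o}.

Definition contractive f := forall z, `|f z| <= `|z|.

Lemma contractive_continuous f : contractive f -> continuous f.
Proof.
move=> cf; apply: bounded_linear_continuous; apply/bounded_funP => r.
by exists r => z; apply: le_trans (cf z).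
Qed.

(** Minimising below the norm shifted by [y], rather than below the norm itself, fixes the value at
    [y]: at [- y] the shift is at most minus the norm of [y]. *)
Lemma norming_functional (y : X) : exists2 f, contractive f & f y = `|y|.
Proof.
pose N (x : X) : R := `|x|.
have sN : sublinear N.
  by split=> [u v|a u a0]; [exact: ler_normD|rewrite /N normrZ gtr0_norm].
have [p [sp pq pmin]] := sublinear_minimal (sublinear_shift_sublinear y sN).
have lp := linear_of_minimal_sublinear sp pmin.
pose f : {linear X -> R^o} := HB.pack (p : X -> R^o)
  (GRing.isLinear.Build R X R^o _ (p : X -> R^o) lp).
have fN z : f z <= `|z| by exact: le_trans (pq z) (sublinear_shift_le _ sN z).
have fopp z : - f z = f (- z) by rewrite linearN.
exists f => [z|].
  by rewrite ler_norml fN andbT lerNl fopp -(normrN z).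
apply/eqP; rewrite eq_le fN /= -lerN2 fopp.
apply: le_trans (pq _) _; apply: le_trans (sublinear_shiftD _ sN _) _.
by rewrite addNr /N normr0 sub0r.
Qed.

End HahnBanach.

(** Continuity bounds [f] on the unit ball, so the supremum in [opnorm] is genuine and dominates the
    value at the normalised [z]. *)
Lemma dual_sphere_contractive (R : realType) (X : normedModType R)
  (f : {linear X -> R^o}) : dual_sphere f -> contractive f.
Proof.
move=> [cf f1] z; have [->|z0] := eqVneq z 0; first by rewrite linear0 !normr0.
have /linear_boundedP/pinfty_ex_gt0[r r0 fr] := (linear_bounded_continuous f).2 cf.
have zgt0 : 0 < `|z| by rewrite normr_gt0.
suff : `|f (`|z|^-1 *: z)| <= 1.
  by rewrite linearZ /= normrM normfV normr_id ler_pdivrMl// mulr1.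
rewrite -f1; apply: ub_le_sup.
  exists r => _ [u u1 <-]; apply: le_trans (fr u) _.
  by rewrite -[leRHS]mulr1 ler_wpM2l// ltW.
exists (`|z|^-1 *: z) => //=.
by rewrite normrZ normfV normr_id mulVf// lt0r_neq0.
Qed.

(** * Rotundity moduli under small perturbations *)

Lemma prod_dist (R : realDomainType) n (a b : 'I_n -> R) e :
  (forall i, `|a i| <= 1) -> (forall i, `|b i| <= 1) ->
  (forall i, `|a i - b i| <= e) ->
  `|\prod_i a i - \prod_i b i| <= n%:R * e.
Proof.
elim: n a b => [|n IH] a b a1 b1 ab; first by rewrite !big_ord0 subrr normr0 mul0r.
rewrite !big_ord_recr /=.
set A := \prod_(i < n) _; set B := \prod_(i < n) _.
have -> : A * a ord_max - B * b ord_max =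
    (A - B) * a ord_max + B * (a ord_max - b ord_max).
  by rewrite mulrBl mulrBr addrA addrNK.
rewrite -natr1 [leRHS]mulrDl mul1r.
apply: le_trans (ler_normD _ _) _; rewrite !normrM; apply: lerD.
  by rewrite -[leRHS]mulr1 ler_pM// IH.
rewrite -[leRHS]mul1r ler_pM//.
by rewrite normr_prod prodr_ile1// => i _; rewrite normr_ge0 b1.
Qed.

(** Leibniz expansion: [n!] signed products, each moving by at most [n * e] when its factors are
    changed one at a time. *)
Lemma det_dist (R : realDomainType) n (A B : 'M[R]_n) e :
  (forall i j, `|A i j| <= 1) -> (forall i j, `|B i j| <= 1) ->
  (forall i j, `|A i j - B i j| <= e) ->
  `|\det A - \det B| <= (n`! * n)%:R * e.
Proof.
move=> A1 B1 AB; rewrite /determinant -sumrB.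
apply: le_trans (ler_norm_sum _ _ _) _.
apply: (@le_trans _ _ (\sum_(s : 'S_n) n%:R * e)).
  apply: ler_sum => s _; rewrite -mulrBr normrMsign.
  exact: prod_dist.
by rewrite sumr_const card_Sn -(mulr_natl (n%:R * e)) natrM mulrA.
Qed.

Section Perturbation.
Context {R : realType} {Z : normedModType R} (k : nat).
Variable f : 'I_k -> {linear Z -> R^o}.

Lemma Ddet_dist (z z' : 'I_k.+1 -> Z) e : 0 <= e ->
  (forall j c, `|f j (z c)| <= 1) -> (forall j c, `|f j (z' c)| <= 1) ->
  (forall j c, `|f j (z c) - f j (z' c)| <= e) ->
  `|Ddet z f - Ddet z' f| <= (k.+1`! * k.+1)%:R * e.
Proof.
move=> e0 z1 z'1 zz'; apply: det_dist => i j; rewrite !mxE;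
  case: (unlift ord0 i) => [l|] //=; by rewrite ?normr1 ?subrr ?normr0.
Qed.

Lemma le_kdelta eps (z : Z) c : c <= 1 ->
  (forall zs : 'I_k -> Z, (forall i, `|zs i| = 1) ->
     eps <= `|Ddet (fcons z zs) f| ->
     `|z + \sum_(i < k) zs i| <= k.+1%:R * (1 - c)) ->
  c <= kdelta eps z f.
Proof.
move=> c1 h; apply: lb_le_inf; first by exists 1; left.
move=> _ [->//|[zs [zs1 zsD] <-]].
rewrite lerBrDr -lerBrDl ler_pdivrMl ?ltr0Sn//; exact: h.
Qed.

Section UnitPoint.
Variable z : Z.
Hypothesis z1 : `|z| <= 1.

Lemma norm_unit_sum (zs : 'I_k -> Z) : (forall i, `|zs i| = 1) ->
  `|z + \sum_(i < k) zs i| <= k.+1%:R.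
Proof.
move=> zs1; apply: le_trans (ler_normD _ _) _; rewrite -natr1 addrC lerD//.
apply: le_trans (ler_norm_sum _ _ _) _.
by rewrite (eq_bigr (fun _ => 1)) ?sumr_const ?card_ord// => i _; rewrite zs1.
Qed.

(** With [z] in the unit ball all the values are nonnegative, so the real infimum is genuine. *)
Let lb eps : has_lbound ([set (1 : R)] `|`
       [set 1 - (k.+1)%:R^-1 * `|z + \sum_(i < k) zs i| | zs in
         [set zs : 'I_k -> Z | (forall i, `|zs i| = 1) /\
                               eps <= `|Ddet (fcons z zs) f| ]]).
Proof.
exists 0 => _ [->//|[zs [zs1 _] <-]].
by rewrite subr_ge0 ler_pdivrMl ?ltr0Sn// mulr1 norm_unit_sum.
Qed.

Lemma kdelta_le1 eps : kdelta eps z f <= 1.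
Proof. by apply: ge_inf; [exact: lb|left]. Qed.

Lemma norm_le_kdelta eps (zs : 'I_k -> Z) : (forall i, `|zs i| = 1) ->
  eps <= `|Ddet (fcons z zs) f| ->
  `|z + \sum_(i < k) zs i| <= k.+1%:R * (1 - kdelta eps z f).
Proof.
move=> zs1 zsD; rewrite -ler_pdivrMl ?ltr0Sn// lerBrDr -lerBrDl.
by apply: ge_inf; [exact: lb|right; exists zs].
Qed.

(** Normalising [w i] moves it by at most [eta], which costs at most [eps / 2] in the determinant
    and [k * eta] in the norm of the sum. This serves both directions: in X for lifts of norm just
    above 1, in X/M for images of norm just below 1. *)
Lemma norm_le_kdelta_perturbed eps eta (w : 'I_k -> Z) :
  (forall j, contractive (f j)) ->
  (forall i, w i != 0) -> (forall i, `| `|w i| - 1 | <= eta) ->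
  (forall j i, `|f j (w i)| <= 1) -> 0 <= eta ->
  (k.+1`! * k.+1)%:R * eta <= eps / 2 ->
  eps <= `|Ddet (fcons z w) f| ->
  `|z + \sum_(i < k) w i| <= k.+1%:R * (1 - kdelta (eps / 2) z f) + k%:R * eta.
Proof.
move=> cf w0 w1 fw eta0 Keta wD.
pose zs i := `|w i|^-1 *: w i.
have zs1 i : `|zs i| = 1 by rewrite normrZ normfV normr_id mulVf// normr_eq0.
have wzs i : `|w i - zs i| <= eta.
  have -> : w i - zs i = (`|w i| - 1) *: zs i.
    by rewrite scalerBl scale1r scalerA mulfV ?scale1r// normr_eq0.
  by rewrite normrZ zs1 mulr1.
have zsD : eps / 2 <= `|Ddet (fcons z zs) f|.
  have : `|Ddet (fcons z w) f - Ddet (fcons z zs) f| <= (k.+1`! * k.+1)%:R * eta.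
    apply: Ddet_dist => // j c; rewrite /fcons; case: (unlift ord0 c) => [i|] /=.
    - exact: fw.
    - exact: le_trans (cf j z) z1.
    - by rewrite -(zs1 i); exact: cf.
    - exact: le_trans (cf j z) z1.
    - by rewrite -linearB; apply: le_trans (cf j _) (wzs i).
    - by rewrite subrr normr0.
  have := ler_normD (Ddet (fcons z w) f - Ddet (fcons z zs) f) (Ddet (fcons z zs) f).
  rewrite subrK; lra.
have -> : z + \sum_(i < k) w i =
    (z + \sum_(i < k) zs i) + \sum_(i < k) (w i - zs i).
  by rewrite sumrB addrA addrAC addrK addrC.
apply: le_trans (ler_normD _ _) _; apply: lerD; first exact: norm_le_kdelta.
apply: le_trans (ler_norm_sum _ _ _) _.
apply: (@le_trans _ _ (\sum_(i < k) eta)); first exact: ler_sum.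
by rewrite sumr_const card_ord mulr_natl.
Qed.

End UnitPoint.
End Perturbation.

(** * Passing to quotients and back *)

Section Quotients.
Context {R : realType} {X : normedModType R}.
Implicit Types (M : closed_subspace X) (f g h : {linear X -> R^o}).

Lemma norm_qproj M z : `|qproj M z| = dist_to z M.
Proof. exact: qnormE. Qed.

Lemma norm_qproj_le M z : `|qproj M z| <= `|z|.
Proof.
by rewrite norm_qproj -[in leRHS](subr0 z); apply/dist_le/subspace0.
Qed.

(** [g] does not distinguish [z] from [z - y] for [y] in [M]. Norming functionals that vanish on [M]
    thus bound quotient norms from below. *)
Lemma contractive_le_dist M g z : contractive g -> M `<=` g @^-1` [set 0] ->
  `|g z| <= dist_to z M.
Proof.
move=> cg Mg; apply: lb_le_inf => [|_ [y My <-]].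
  by exists `|z - 0|, 0 => //; exact: subspace0.
have -> : g z = g (z - y) by rewrite linearB (_ : g y = 0) ?subr0//; exact: Mg.
exact: cg.
Qed.

Lemma qfun_contractive M f (hf : M `<=` f @^-1` [set 0]) :
  contractive f -> contractive (qfun hf).
Proof. by move=> cf u; exact: contractive_le_dist. Qed.

Lemma Ddet_qproj M k (f : 'I_k -> {linear X -> R^o})
    (hM : forall j, M `<=` f j @^-1` [set 0]) x (w : 'I_k -> X) zs :
  (forall i, zs i = qproj M (w i)) ->
  Ddet (fcons (qproj M x) zs) (fun j => qfun (hM j)) = Ddet (fcons x w) f.
Proof.
move=> zsE; rewrite /Ddet; congr (\det _); apply/matrixP => i j; rewrite !mxE.
case: (unlift ord0 i) => [l|//] /=; rewrite /fcons.
by case: (unlift ord0 j) => [m|] /=; rewrite ?zsE; exact: qfunE.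
Qed.

Lemma qproj_sum M k x (w : 'I_k -> X) :
  qproj M x + \sum_(i < k) qproj M (w i) = qproj M (x + \sum_(i < k) w i).
Proof. by rewrite qprojD raddf_sum. Qed.

Variables (k : nat) (x : X).
Hypothesis x1 : `|x| = 1.

(** The lower bound does not involve [M], so it survives the infimum over all subspaces. *)
Lemma kdelta_quotient_ge M (f : 'I_k -> {linear X -> R^o})
    (hM : forall j, M `<=` f j @^-1` [set 0]) eps :
  0 < eps -> (forall j, contractive (f j)) -> 0 < kdelta (eps / 2) x f ->
  kdelta (eps / 2) x f / 2 <= kdelta eps (qproj M x) (fun j => qfun (hM j)).
Proof.
move=> eps0 cf; set d := kdelta _ _ _ => d0.
have d1 : d <= 1 by apply: kdelta_le1; rewrite x1.
apply: le_kdelta => [|zs zs1 zsD]; first lra.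
have K0 : 0 < (k.+1`! * k.+1)%:R :> R by rewrite ltr0n muln_gt0 fact_gt0.
(* The first entry is chosen for [(k+1)(1 - d) + k d / 2 <= (k+1)(1 - d / 2)], the second to lose at
   most [eps / 2] in the determinant. *)
pose eta := Num.min (d / 2) (eps / 2 / (k.+1`! * k.+1)%:R).
have eta0 : 0 < eta by rewrite lt_min !divr_gt0.
have /choice[w wP] i : exists w, zs i = qproj M w /\ `|w| < 1 + eta.
  have [|y My yd] := @dist_lt _ _ M (qrepr (zs i)) (1 + eta).
    by rewrite -norm_qproj qreprK zs1 ltrDl.
  exists (qrepr (zs i) - y); split=> //.
  by rewrite -[LHS]qreprK; apply/qproj_eq; rewrite subKr.
have w1 i : 1 <= `|w i| by rewrite -(zs1 i) (wP i).1 norm_qproj_le.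
have := @norm_le_kdelta_perturbed _ _ k f x _ eps eta w cf.
rewrite x1 -/d => /(_ (lexx _)) h.
have {h} : `|x + \sum_(i < k) w i| <= k.+1%:R * (1 - d) + k%:R * eta.
  apply: h => [i|i|j i|||].
  - by rewrite -normr_gt0 (lt_le_trans _ (w1 i)).
  - by rewrite ger0_norm ?subr_ge0// lerBlDl ltW// (wP i).2.
  (* The lift may be longer than 1, but [f j] sees only its class, of norm 1. *)
  - have := qfun_contractive (hM j) (cf j) (qproj M (w i)).
    by rewrite -(wP i).1 zs1 (wP i).1 /= qfunE.
  - exact: ltW.
  - by rewrite mulrC -ler_pdivlMr// ge_min lexx orbT.
  - by move: zsD; rewrite (Ddet_qproj hM x (fun i => (wP i).1)).
have -> : \sum_(i < k) zs i = \sum_(i < k) qproj M (w i).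
  by apply: eq_bigr => i _; exact: (wP i).1.
rewrite qproj_sum; have := norm_qproj_le M (x + \sum_(i < k) w i).
have : k%:R * eta <= k%:R * (d / 2) by rewrite ler_wpM2l// ge_min lexx.
have -> : k.+1%:R = k%:R + 1 :> R by rewrite natr1.
have : 0 <= k%:R :> R by [].
nra.
Qed.

Lemma quotient_deltas_gt0 P eps (f : 'I_k -> {linear X -> R^o}) :
  WLUR_at k x -> 0 < eps -> (forall j, dual_sphere (f j)) ->
  (0 < ereal_inf (quotient_deltas P eps x f))%E.
Proof.
move=> xW eps0 sf.
have d0 : 0 < kdelta (eps / 2) x f by apply: xW; rewrite ?divr_gt0.
apply: (@lt_le_trans _ _ (kdelta (eps / 2) x f / 2)%:E).
  by rewrite lte_fin divr_gt0.
apply: le_ereal_inf_tmp => _ [M [hM [_ _ ->]]]; rewrite lee_fin.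
by apply: kdelta_quotient_ge => // j; exact: dual_sphere_contractive.
Qed.

(* The quotient is taken by a subspace of the kernels of functionals norming
   [x] and [x + \sum_i zs i]: then [x] keeps norm 1, the sum keeps its norm,
   and each [zs i] nearly does. *)
Lemma WLUR_of_quotient_deltas P :
  (forall (f : 'I_k -> {linear X -> R^o}) g h,
    (forall j, continuous (f j)) -> continuous g -> continuous h ->
    exists M, [/\ P M, forall j, M `<=` f j @^-1` [set 0],
      M `<=` g @^-1` [set 0] & M `<=` h @^-1` [set 0]]) ->
  (forall eps (f : 'I_k -> {linear X -> R^o}),
    0 < eps -> (forall j, dual_sphere (f j)) ->
    (0 < ereal_inf (quotient_deltas P eps x f))%E) ->
  WLUR_at k x.
Proof.
move=> exM infP eps f eps0 sf.
have cf j : contractive (f j) by exact: dual_sphere_contractive.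
(* The infimum is [+oo] when no subspace qualifies; [c0 = 1] is taken then. *)
have [c0 c00 c0P] : exists2 c0 : R, 0 < c0 &
    (c0%:E <= ereal_inf (quotient_deltas P (eps / 2) x f))%E.
  have := infP (eps / 2) f; case: ereal_inf => [r||] /(_ _ sf) h.
  - by exists r => //; rewrite -lte_fin; apply: h; rewrite divr_gt0.
  - by exists 1 => //; rewrite leey.
  - by exfalso; have := h ltac:(by rewrite divr_gt0).
have K0 : 0 < (k.+1`! * k.+1)%:R :> R by rewrite ltr0n muln_gt0 fact_gt0.
(* [1 / 2] keeps the images of the [zs i] nonzero, the second entry limits the loss in the
   determinant to [eps / 2], and [c0] yields the final contradiction. *)
pose eta := Num.min (Num.min (1 / 2) (eps / 2 / (k.+1`! * k.+1)%:R)) c0.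
have eta0 : 0 < eta by rewrite !lt_min c00 !divr_gt0.
have eta1 : eta <= 1 / 2 by rewrite !ge_min lexx.
have etaK : (k.+1`! * k.+1)%:R * eta <= eps / 2.
  by rewrite mulrC -ler_pdivlMr// !ge_min lexx orbT.
have etac0 : eta <= c0 by rewrite ge_min lexx orbT.
have k10 : 0 < k.+1%:R :> R by rewrite ltr0Sn.
have kE : k.+1%:R = k%:R + 1 :> R by rewrite natr1.
have k0 : 0 <= k%:R :> R by [].
apply: (@lt_le_trans _ _ (eta / k.+1%:R)); first by rewrite divr_gt0.
apply: le_kdelta => [|zs zs1 zsD].
  by rewrite ler_pdivrMr// mul1r kE; lra.
rewrite mulrBr mulr1 mulrCA mulfV ?mulr1 ?lt0r_neq0// leNgt.
set s := `|_|; apply/negP => hs.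
have [g cg gE] := norming_functional (x + \sum_(i < k) zs i).
have [h ch hE] := norming_functional x.
have [M [PM Mf Mg Mh]] := exM f g h (fun j => contractive_continuous (cf j))
  (contractive_continuous cg) (contractive_continuous ch).
have dx : dist_to x M = 1.
  apply/eqP; rewrite eq_le -norm_qproj -{1}x1 norm_qproj_le /=.
  by rewrite norm_qproj -x1 -hE (le_trans (ler_norm _))// contractive_le_dist.
have sM : s <= `|qproj M x + \sum_(i < k) qproj M (zs i)|.
  rewrite qproj_sum norm_qproj /s -gE (le_trans (ler_norm _))//.
  exact: contractive_le_dist.
have qzs i : 1 - eta <= `|qproj M (zs i)| <= 1.
  rewrite -{2}(zs1 i) norm_qproj_le andbT norm_qproj.
  apply: (@le_trans _ _ (g (zs i))); last first.
    by rewrite (le_trans (ler_norm _))// contractive_le_dist.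
  (* The [k] other terms, [x] included, contribute at most 1 each to the value of [g], which leaves
     more than [1 - eta] for [g (zs i)]. *)
  suff : s <= k%:R + g (zs i) by rewrite kE in hs; lra.
  rewrite /s -gE linearD linear_sum (bigD1 i)//= addrCA addrC lerD2r.
  apply: (@le_trans _ _ (1 + \sum_(j < k | j != i) 1)).
    apply: lerD; first by rewrite -x1 (le_trans (ler_norm _)).
    by apply: ler_sum => j _; rewrite -(zs1 j) (le_trans (ler_norm _)).
  have -> : k%:R = \sum_(j < k) 1 :> R by rewrite sumr_const card_ord.
  by rewrite [leRHS](bigD1 i).
have := c0P; have : quotient_deltas P (eps / 2) x f
    (kdelta (eps / 2) (qproj M x) (fun j => qfun (Mf j)))%:E by exists M, Mf.
move=> /ereal_inf_lbound /[swap] /le_trans /[apply]; rewrite lee_fin => c0d.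
have qx1 : `|qproj M x| <= 1 by rewrite norm_qproj dx.
suff : `|qproj M x + \sum_(i < k) qproj M (zs i)| <=
    k.+1%:R * (1 - kdelta (eps / 2) (qproj M x) (fun j => qfun (Mf j))) +
    k%:R * eta.
  (* Together with [s > k + 1 - eta] this gives [(k+1) delta < (k+1) eta], where [delta] is the
     modulus of the quotient and [delta >= c0 >= eta]. *)
  by move: hs sM c0d; rewrite kE; nra.
apply: norm_le_kdelta_perturbed => // [j|i|i|j i||].
- exact: qfun_contractive.
- by rewrite -normr_gt0; have /andP[] := qzs i; lra.
- by have /andP[] := qzs i; rewrite ler_norml; lra.
- rewrite (le_trans (qfun_contractive _ (cf j) _))//.
  by have /andP[] := qzs i.
- exact: ltW.
- by rewrite (@Ddet_qproj _ _ _ Mf x zs).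
Qed.

End Quotients.

(** * Biorthogonal systems and dimension *)

Section Dimension.
Context {R : realType} {V : lmodType R}.

(** The coefficients form a nonzero vector in the left kernel of the [n] by [m] matrix of values,
    whose rank is at most [m < n]. *)
Lemma exists_common_kernel m n (v : 'I_n -> V) (psi : 'I_m -> {linear V -> R^o}) :
  (m < n)%N -> exists c : 'I_n -> R, (exists i, c i != 0) /\
    forall j, psi j (\sum_(i < n) c i *: v i) = 0.
Proof.
move=> mn; pose A : 'M[R]_(n, m) := \matrix_(i, j) psi j (v i).
have : kermx A != 0.
  rewrite kermx_eq0 /row_free neq_ltn; apply/orP; left.
  exact: leq_ltn_trans (rank_leq_col A) mn.
move=> /rowV0Pn[r /sub_kermxP rA /rV0Pn[i ri]].
exists (fun i => r 0 i); split; first by exists i.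
move=> j; have := congr1 (fun B : 'rV_m => B 0 j) rA; rewrite !mxE => <-.
rewrite linear_sum; apply: eq_bigr => l _.
by rewrite linearZ !mxE.
Qed.

Lemma dimension_geP n (A : set V) : (n%:R%:E <= dimension A)%E ->
  exists v : 'I_n -> V, (forall i, A (v i)) /\ lin_indep v.
Proof.
case: n => [_|n dA].
  by exists (fun=> 0); split=> [[]|c _ []].
have /ereal_sup_gt[_ [m [v [Av vI]] <-]] : (n%:R%:E < dimension A)%E.
  by apply: lt_le_trans dA; rewrite lte_fin ltr_nat.
rewrite lte_fin ltr_nat => nm.
exists (fun i => v (widen_ord nm i)); split=> // c c0 i.
(* The coefficients are extended by zero to the whole family, which may have more than [n.+1]
   vectors. *)
pose c' (j : 'I_m) := oapp c 0 (insub (j : nat) : option 'I_n.+1).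
have c'E j : c' (widen_ord nm j) = c j by rewrite /c' /= valK.
rewrite -c'E; apply: vI; rewrite (bigID (fun j : 'I_m => (j < n.+1)%N)) /=.
rewrite [X in _ + X]big1 ?addr0 => [|j jn]; last first.
  by rewrite /c' insubN //= scale0r.
by rewrite (big_ord_narrow nm) -[RHS]c0; apply: eq_bigr => j _; rewrite c'E.
Qed.

(** More than [n] vectors of [A] have a nontrivial combination killed by every [psi i], hence zero;
    and applying [psi i] to a relation between the [u j] isolates its coefficient at [i]. *)
Lemma dimension_biorthogonal n (A : set V) (u : 'I_n -> V)
    (psi : 'I_n -> {linear V -> R^o}) :
  A 0 -> (forall a x y, A x -> A y -> A (a *: x + y)) ->
  (forall i, A (u i)) -> (forall i j, psi i (u j) = (i == j)%:R) ->
  (forall x, A x -> (forall i, psi i x = 0) -> x = 0) ->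
  dimension A = n%:R%:E.
Proof.
move=> A0 AZ Au psiu psiA; apply/eqP; rewrite eq_le; apply/andP; split.
  apply: ge_ereal_sup => _ [m [v [Av vI]] <-]; rewrite lee_fin ler_nat leqNgt.
  apply/negP => nm; have [c [[i ci] cpsi]] := exists_common_kernel v psi nm.
  move/eqP: ci; apply; apply: vI; apply: psiA => //.
  apply: big_ind => // [x y Ax Ay|j _]; first by rewrite -[x]scale1r; exact: AZ.
  by rewrite -[_ *: _]addr0; exact: AZ.
apply: ereal_sup_ubound; exists n => //; exists u; split=> // c c0 i.
have := congr1 (psi i) c0; rewrite linear0 linear_sum (bigD1 i)//= big1.
  by rewrite linearZ /= psiu eqxx addr0; apply: etrans; rewrite [RHS]mulr1.
by move=> j ji; rewrite linearZ /= psiu eq_sym (negbTE ji) [LHS]mulr0.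
Qed.

End Dimension.

Section Biorthogonal.
Context {R : realType} {X : normedModType R}.

(** Used with [phi] a functional, to correct it at earlier vectors, and with [phi] the identity, to
    subtract a projection onto a span. *)
Lemma linear_sub_lincomb (W : normedModType R) (phi : {linear X -> W})
    (psi : nat -> {linear X -> R^o}) (w : nat -> W) n :
  continuous phi -> (forall i, continuous (psi i)) ->
  exists g : {linear X -> W}, continuous g /\
    forall x, g x = phi x - \sum_(i < n) psi i x *: w i.
Proof.
move=> cphi cpsi; pose g x : W := phi x - \sum_(i < n) psi i x *: w i.
have lg : linear g.
  move=> a x y; rewrite /g linearP scalerBr scaler_sumr addrACA -opprD -big_split.
  congr (_ - _); apply: eq_bigr => i _.
  by rewrite linearP scalerDl scalerA.
pose G : {linear X -> W} := HB.pack g (GRing.isLinear.Build R X W _ g lg).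
exists G; split=> // x.
apply: cvgB; first exact: cphi.
apply: cvg_big => [|i _]; first exact: add_continuous.
by apply: cvgZr_tmp; exact: cpsi.
Qed.

Lemma closed_common_kernel (W : normedModType R) I (g : I -> {linear X -> W}) :
  (forall i, continuous (g i)) ->
  exists M : closed_subspace X, forall x, subspace_set M x <-> forall i, g i x = 0.
Proof.
move=> cg; pose S := \bigcap_i (g i @^-1` [set 0]).
have SP x : S x <-> forall i, g i x = 0.
  by split=> [h i|h i _]; [exact: h|exact: h].
have sS : submod_closed (fun x => `[< S x >]).
  split=> [|a x y /asboolP/SP xS /asboolP/SP yS].
    by apply/asboolP/SP => i; rewrite linear0.
  by apply/asboolP/SP => i; rewrite linearP xS yS scaler0 addr0.
have cS : closed S.
  apply: closed_bigI => i _; apply: preimage_closed; last exact/accessible_closed_set1/hausdorff_accessible/norm_hausdorff.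
  by move=> x _; exact: cg.
by exists (ClosedSubspace sS cS).
Qed.

(** A Gram-Schmidt process on the functionals; the independent [v] ensure that fewer than [n]
    functionals have a nonzero common zero. By the triangular third clause, [u l] lies in the kernel
    of [f i] for [i < l < n]. *)
Lemma exists_biorthogonal n (v : 'I_n -> X) (f : nat -> {linear X -> R^o}) :
  lin_indep v -> (forall i, continuous (f i)) ->
  exists (u : nat -> X) (psi : nat -> {linear X -> R^o}),
  [/\ forall i, continuous (psi i),
      forall i j, (i < n)%N -> (j < n)%N -> psi i (u j) = (i == j)%:R &
      forall i x, (i < n)%N -> (forall j, (j <= i)%N -> psi j x = 0) -> f i x = 0].
Proof.
move=> vI cf.
suff: forall m, (m <= n)%N -> exists (u : nat -> X) (psi : nat -> {linear X -> R^o}),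
  [/\ forall i, continuous (psi i),
      forall i j, (i < m)%N -> (j < m)%N -> psi i (u j) = (i == j)%:R &
      forall i x, (i < m)%N -> (forall j, (j <= i)%N -> psi j x = 0) -> f i x = 0].
  exact.
elim=> [_|m IH mn]; first by exists (fun=> 0), f.
have [u [psi [cpsi psiu psif]]] := IH (ltnW mn).
(* Take [phi = f m] unless [f m] already vanishes on the common kernel of the
   previous [psi i]; then any functional not vanishing there will do. *)
have [a [phi [aK cphi phia phif]]] : exists (a : X) (phi : {linear X -> R^o}),
    [/\ forall i, (i < m)%N -> psi i a = 0, continuous phi, phi a = 1 &
      forall x, (forall i, (i < m)%N -> psi i x = 0) -> phi x = 0 -> f m x = 0].
  have [[a [aK fa]]|fK] := pselect (exists a, (forall i, (i < m)%N -> psi i a = 0) /\ f m a != 0).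
    exists ((f m a)^-1 *: a), (f m); split=> // [i im|].
      by rewrite linearZ /= aK// scaler0.
    by rewrite linearZ /= [LHS]mulVf.
  have [c [[i ci] cpsi0]] := exists_common_kernel v (fun j : 'I_m => psi j) mn.
  pose a := \sum_(i < n) c i *: v i.
  have a0 : a != 0 by apply: contra_neq ci => a0; exact: vI.
  have [phi cphi phia] := norming_functional a.
  exists (`|a|^-1 *: a), phi; split=> [j jm|||x xK _].
  - by rewrite linearZ /= (cpsi0 (Ordinal jm)) scaler0.
  - exact: contractive_continuous.
  - by rewrite linearZ /= phia [LHS]mulVf// normr_eq0.
  - by apply/eqP/negPn/negP => fx; apply: fK; exists x.
(* [chi] vanishes at the earlier [u i], and still equals [phi] where the earlier [psi i] vanish, in
   particular at [a]. *)
have [chi [cchi chiE]] := linear_sub_lincomb (fun i => phi (u i)) m cphi cpsi.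
have chiK x : (forall i, (i < m)%N -> psi i x = 0) -> chi x = phi x.
  by move=> xK; rewrite chiE big1 ?subr0// => i _; rewrite xK// scale0r.
exists (fun i => if i == m then a else u i), (fun i => if i == m then chi else psi i).
split=> [i|i j|i x].
- by case: ifP.
- rewrite !ltnS; have [->|im] := eqVneq i m; have [->|jm] := eqVneq j m => hi hj.
  + by rewrite chiK.
  + have {}hj : (j < m)%N by rewrite ltn_neqAle jm.
    rewrite chiE (bigD1 (Ordinal hj))//= psiu// eqxx scale1r.
    rewrite big1 ?addr0 ?subrr// => l lj; rewrite psiu//.
    by rewrite -val_eqE /= in lj; rewrite (negbTE lj) scale0r.
  + have {}hi : (i < m)%N by rewrite ltn_neqAle im.
    by rewrite aK// (negbTE im).
  + by apply: psiu; rewrite ltn_neqAle ?im ?jm.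
- rewrite ltnS => im h; have psix j : (j <= i)%N -> (j < m)%N -> psi j x = 0.
    by move=> ji jm; have := h j ji; rewrite ltn_eqF.
  have [im'|im'] := eqVneq i m; last first.
    have {}im : (i < m)%N by rewrite ltn_neqAle im' im.
    by apply: psif => // j ji; apply: psix => //; exact: leq_ltn_trans im.
  rewrite im' in h psix *.
  have xK j : (j < m)%N -> psi j x = 0 by move=> jm; rewrite psix// ltnW.
  by apply: phif => //; rewrite -chiK//; have := h m (leqnn m); rewrite eqxx.
Qed.

(** [M] is the span of the last [a] vectors of a biorthogonal system, closed as the kernel of the
    identity minus a continuous projection. The first [m] functionals [psi j] vanish on it, hence so
    do the [f i]. *)
Lemma exists_subspace_dim m a (v : 'I_(m + a) -> X) (f : 'I_m -> {linear X -> R^o}) :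
  lin_indep v -> (forall i, continuous (f i)) ->
  exists M : closed_subspace X,
    dimension M = a%:R%:E /\ forall i, M `<=` f i @^-1` [set 0].
Proof.
move=> vI cf; pose f' i := oapp f \0 (insub i).
have cf' i : continuous (f' i).
  by rewrite /f'; case: insub => [j|] /=; [exact: cf|exact: cst_continuous].
have [u [psi [cpsi psiu psif]]] := exists_biorthogonal vI cf'.
have [g [cg gE]] := @linear_sub_lincomb X idfun (fun i => psi (m + i)%N)
  (fun i => u (m + i)%N) a (fun x => cvg_id) (fun i => cpsi _).
have [M MP] := @closed_common_kernel X unit (fun=> g) (fun=> cg).
have {}MP x : subspace_set M x <-> x = \sum_(i < a) psi (m + i)%N x *: u (m + i)%N.
  rewrite MP gE; split=> [/(_ tt)/eqP|h _]; first by rewrite subr_eq0 => /eqP.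
  by rewrite -h subrr.
have lt_ma (i : 'I_a) : (m + i < m + a)%N by rewrite ltn_add2l.
exists M; split.
  apply: (@dimension_biorthogonal _ _ a M (fun i => u (m + i)%N) (fun i => psi (m + i)%N)).
  - exact: subspace0.
  - by move=> b x y Mx My; apply: subspaceD => //; exact: subspaceZ.
  - move=> i; apply/MP; rewrite (bigD1 i)//= psiu// eqxx scale1r big1 ?addr0//.
    by move=> j ji; rewrite psiu// eqn_add2l val_eqE (negbTE ji) scale0r.
  - by move=> i j; rewrite psiu// eqn_add2l.
  - by move=> x /MP xE xK; rewrite xE big1// => i _; rewrite xK scale0r.
move=> i x /MP xE; have := psif i x (ltn_addr a (ltn_ord i)).
rewrite /f' valK /=; apply=> j ji.
have jm : (j < m)%N := leq_ltn_trans ji (ltn_ord i).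
rewrite xE linear_sum big1// => l _; rewrite linearZ /= psiu ?lt_ma ?(ltn_addr a jm)//.
by rewrite ltn_eqF ?(ltn_addr l jm)// [LHS]mulr0.
Qed.

(** [M] is the common kernel of [b] functionals [psi i]; with the functionals they induce, the
    classes of the [u i] are biorthogonal in X/M. By [m <= b] these [psi i] control every [f i]. *)
Lemma exists_subspace_codim m b (v : 'I_b -> X) (f : 'I_m -> {linear X -> R^o}) :
  (m <= b)%N -> lin_indep v -> (forall i, continuous (f i)) ->
  exists M : closed_subspace X,
    codimension M = b%:R%:E /\ forall i, M `<=` f i @^-1` [set 0].
Proof.
move=> mb vI cf; pose f' i := oapp f \0 (insub i).
have cf' i : continuous (f' i).
  by rewrite /f'; case: insub => [j|] /=; [exact: cf|exact: cst_continuous].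
have [u [psi [cpsi psiu psif]]] := exists_biorthogonal vI cf'.
have [M MP] := @closed_common_kernel R^o 'I_b (fun i => psi i) (fun i => cpsi i).
have Mpsi (i : 'I_b) : M `<=` psi i @^-1` [set 0] by move=> x /MP/(_ i).
exists M; split.
  apply: (@dimension_biorthogonal _ _ b _ (fun i => qproj M (u i)) (fun i => qfun (Mpsi i))) => //.
  - by move=> i j; rewrite /= qfunE psiu.
  - move=> x _ xK; rewrite -[x]qreprK -(raddf0 (qproj M)); apply/qproj_eq.
    by rewrite subr0; apply/MP => i; have := xK i; rewrite /= /qfun.
move=> i x /MP xK; have := psif i x (leq_trans (ltn_ord i) mb).
rewrite /f' valK /=; apply=> j ji.
by rewrite (xK (Ordinal (leq_ltn_trans ji (leq_trans (ltn_ord i) mb)))).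
Qed.

End Biorthogonal.

(** * Closing the cycle of implications *)

Lemma subspace_in_kernels (R : realType) (X : normedModType R) k
    (P : closed_subspace X -> Prop) :
  (forall f : 'I_(k + 2) -> {linear X -> R^o}, (forall i, continuous (f i)) ->
    exists M, P M /\ forall i, M `<=` f i @^-1` [set 0]) ->
  forall (f : 'I_k -> {linear X -> R^o}) (g h : {linear X -> R^o}),
    (forall j, continuous (f j)) -> continuous g -> continuous h ->
    exists M, [/\ P M, forall j, M `<=` f j @^-1` [set 0],
      M `<=` g @^-1` [set 0] & M `<=` h @^-1` [set 0]].
Proof.
move=> exM f g h cf cg ch.
pose F (i : 'I_(k + 2)) := match fintype.split i with
  | inl j => f j | inr l => if l == ord0 then g else h end.
have cF i : continuous (F i).
  by rewrite /F; case: fintype.split => [j|l]; [exact: cf|case: ifP].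
have [M [PM MF]] := exM F cF; exists M; split=> // [j||].
- have := MF (unsplit (inl j)); by rewrite /F unsplitK.
- have := MF (unsplit (inr ord0)); by rewrite /F unsplitK.
- have := MF (unsplit (inr ord_max)); by rewrite /F unsplitK.
Qed.

Theorem theorem4p3 (R : realType) (X : completeNormedModType R)
    (k alpha beta : nat) (x : X) :
  (0 < k)%N -> (0 < alpha)%N -> (0 < beta)%N ->
  ((k + 3)%:R%:E <= dimension [set: X])%E ->
  (alpha%:R%:E <= dimension [set: X] - (k + 2)%:R%:E)%E ->
  (k + 2 <= beta)%N -> (beta%:R%:E <= dimension [set: X] - 1%:E)%E ->
  `|x| = 1 ->
  [<-> WLUR_at k x ;
       forall (eps : R) (f : 'I_k -> {linear X -> R^o}),
         0 < eps -> (forall j, dual_sphere (f j)) ->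
         (0 < ereal_inf (quotient_deltas (fun M => True) eps x f))%E ;
       forall (eps : R) (f : 'I_k -> {linear X -> R^o}),
         0 < eps -> (forall j, dual_sphere (f j)) ->
         (0 < ereal_inf
            (quotient_deltas (fun F => dimension F = alpha%:R%:E) eps x f))%E ;
       forall (eps : R) (f : 'I_k -> {linear X -> R^o}),
         0 < eps -> (forall j, dual_sphere (f j)) ->
         (0 < ereal_inf
            (quotient_deltas (fun Y => codimension Y = beta%:R%:E) eps x f))%E ].
Proof.
move=> _ _ _ _ alphaX kbeta betaX x1.
have deltasS P eps (f : 'I_k -> {linear X -> R^o}) :
    (ereal_inf (quotient_deltas (fun=> True) eps x f) <=
     ereal_inf (quotient_deltas P eps x f))%E.
  by apply: ereal_inf_le_tmp => _ [M [hM [_ dM ->]]]; exists M, hM.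
tfae.
- by move=> xW eps f; exact: quotient_deltas_gt0.
- by move=> infX eps f eps0 sf; apply: lt_le_trans (deltasS _ _ _); exact: infX.
(* (3) reaches (4) through (1): subspaces of dimension [alpha] already give rotundity at [x]. *)
- move=> infX eps f eps0 sf; apply: quotient_deltas_gt0 => //.
  apply: WLUR_of_quotient_deltas infX => //; apply: subspace_in_kernels => F cF.
  (* The upper bound on [alpha] leaves [k + 2] vectors to pair with the kernels and [alpha] more to
     span the subspace. *)
  have /dimension_geP[v [_ vI]] :
      ((k + 2 + alpha)%:R%:E <= dimension [set: X])%E.
    by rewrite addnC natrD EFinD -leeBrDr.
  exact: exists_subspace_dim vI cF.
- apply: WLUR_of_quotient_deltas => //; apply: subspace_in_kernels => F cF.
  have /dimension_geP[v [_ vI]] : (beta%:R%:E <= dimension [set: X])%E.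
    by apply: le_trans betaX _; rewrite leeBlDr// leeDl// lee_fin.
  exact: exists_subspace_codim kbeta vI cF.
Qed.
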